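(* Let $A$ and $B$ be connected graphs such that $A \triangleright B$. Then $|V(B)|$ divides $2|V(A)|$. If, moreover, $A$ has no semi-edges, then $|V(B)|$ divides $|V(A)|$.
   Context: A graph has finite vertex and edge sets; every edge is a normal edge (two distinct end-vertices, adding 1 to each degree), a loop (one vertex, adding 2 to its degree) or a semi-edge (one vertex, adding 1 to its degree); multiple loops, semi-edges and parallel edges are allowed. A graph is simple if it has no loops, semi-edges or parallel normal edges. A covering projection from $G$ to a connected graph $H$ is a pair of surjective maps $f_V:V(G)\to V(H)$, $f_E:E(G)\to E(H)$ with $f_V$ degree preserving, $f_E$ mapping semi-edges onto semi-edges and loops onto loops (normal edges may go to normal edges, loops or semi-edges), $f_E$ incidence preserving, and $f_E$ a local bijection between the edge-neighborhoods of each vertex and its image (so the preimage of a loop at $u$ is a disjoint union of cycles spanning $f_V^{-1}(u)$, the preimage of a semi-edge at $u$ consists of semi-edges and normal edges covering each vertex of $f_V^{-1}(u)$ exactly once, and the preimage of a normal edge $uv$ is a perfect matching between $f_V^{-1}(u)$ and $f_V^{-1}(v)$). $G\longrightarrow H$ means such a projection exists. $A \triangleright B$ means: every simple graph $G$ with $G\longrightarrow A$ satisfies $G\longrightarrow B$. *)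

(* Defs.v *)
From HB Require Import structures.
From mathcomp Require Import all_boot.

Set Implicit Arguments.
Unset Strict Implicit.
Unset Printing Implicit Defensive.

Variant edge_kind := Normal | Loop | Semi.

Record graph := Graph {
  vertex : finType;
  edge : finType;
  kind : edge -> edge_kind;
  ends : edge -> {set vertex};
  ends_card : forall e, #|ends e| = if kind e is Normal then 2 else 1
}.

Arguments kind {g} e.
Arguments ends {g} e.

(* The contribution of e to the degree of u. *)
Definition incidence (G : graph) (u : vertex G) (e : edge G) : nat :=
  if u \in ends e then (if kind e is Loop then 2 else 1) else 0.

Definition degree (G : graph) (u : vertex G) : nat :=
  \sum_(e : edge G) incidence u e.

(* The edge-neighborhood of u is a multiset (a sequence up to permutation) in
   which a loop at u occurs twice, once for each of its ends. *)
Definition edge_nbhd (G : graph) (u : vertex G) : seq (edge G) :=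
  flatten [seq nseq (incidence u e) e | e <- enum (edge G)].

Definition adjacent (G : graph) : rel (vertex G) :=
  fun u v => [exists e : edge G, (u \in ends e) && (v \in ends e)].

Definition connected (G : graph) : Prop :=
  forall u v : vertex G, connect (@adjacent G) u v.

Definition simple (G : graph) : Prop :=
  (forall e : edge G, kind e = Normal) /\ injective (@ends G).

Definition has_no_semi_edges (G : graph) : Prop :=
  forall e : edge G, kind e <> Semi.

(* Because a loop is counted twice in an edge-neighborhood, cp_local_bij makes
   a loop at fV u be covered, at u, either by one loop or by two normal edges
   (so its preimage is a disjoint union of cycles), whereas a semi-edge or a
   normal edge at fV u is covered, at u, by exactly one edge. *)
Record covering_projection (G H : graph)
    (fV : vertex G -> vertex H) (fE : edge G -> edge H) : Prop := {
  cp_surjV : forall x : vertex H, exists u, fV u = x;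
  cp_surjE : forall d : edge H, exists e, fE e = d;
  cp_degree : forall u, degree (fV u) = degree u;
  cp_semi : forall e, kind e = Semi -> kind (fE e) = Semi;
  cp_loop : forall e, kind e = Loop -> kind (fE e) = Loop;
  cp_incidence : forall e, ends (fE e) = fV @: ends e;
  cp_local_bij : forall u, perm_eq (map fE (edge_nbhd u)) (edge_nbhd (fV u))
}.

Definition covers (G H : graph) : Prop :=
  exists (fV : vertex G -> vertex H) (fE : edge G -> edge H),
    covering_projection fV fE.

Definition stronger (A B : graph) : Prop :=
  forall G : graph, simple G -> covers G A -> covers G B.

(* Main.v *)
(** All fibers of a covering of a connected graph B have the same size, so
    |V(B)| divides |V(G)| for every simple graph G covering A.  If A has no
    semi-edges, shifts of Z/k by pairwise distinct residues give a simple
    k-fold cover of A for every large k; two consecutive values of k yield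
    |V(B)| | |V(A)|.  With semi-edges the same works on two copies of Z/k,
    exchanged by the semi-edges, whence the factor 2. *)
Require Import Defs.
From mathcomp Require Import all_boot all_fingroup all_algebra.
From mathcomp Require Import zify.

Set Implicit Arguments.
Unset Strict Implicit.
Unset Printing Implicit Defensive.

Import GRing.Theory.

(** * Multiplicities in edge-neighborhoods *)

Lemma count_map_edge_nbhd (G : graph) (T : eqType) (f : edge G -> T) u d :
  count_mem d (map f (edge_nbhd u)) = \sum_(e | f e == d) incidence u e.
Proof.
rewrite count_map /edge_nbhd count_flatten -map_comp sumnE big_map.
rewrite big_enum [RHS]big_mkcond; apply: eq_bigr => e _ /=.
by rewrite count_nseq /=; case: (f e == d); rewrite ?mul1n ?mul0n.
Qed.

Lemma count_edge_nbhd (G : graph) (u : vertex G) d :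
  count_mem d (edge_nbhd u) = incidence u d.
Proof. by rewrite -[edge_nbhd u]map_id count_map_edge_nbhd big_pred1_eq. Qed.

Lemma size_edge_nbhd (G : graph) (u : vertex G) :
  size (edge_nbhd u) = degree u.
Proof.
rewrite /edge_nbhd size_flatten /shape -map_comp sumnE big_map big_enum.
by apply: eq_bigr => e _ /=; rewrite size_nseq.
Qed.

(** * Fibers of a covering projection *)

Section ConstantFibers.

Variables (G H : graph) (fV : vertex G -> vertex H) (fE : edge G -> edge H).
Hypothesis fP : covering_projection fV fE.

(* Double counting of the incidences between the fiber of x and that of d. *)
Lemma card_fiber_end d x : kind d = Normal -> x \in ends d ->
  #|[set u | fV u == x]| = #|[set e | fE e == d]|.
Proof.
move=> dN xd.
have incE u : fV u = x -> \sum_(e | fE e == d) incidence u e = 1.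
  (* By local bijectivity, [d] has the same multiplicity around [u] as around [x]. *)
  move=> ux; rewrite -count_map_edge_nbhd.
  rewrite (seq.permP (cp_local_bij fP u)) count_edge_nbhd.
  by rewrite /incidence ux xd dN.
have incV e : fE e = d -> \sum_(u | fV u == x) incidence u e = 1.
  move=> ed; have endE := cp_incidence fP e; rewrite ed in endE.
  (* [fV] maps [ends e] onto the two ends of [d], so [ends e] is not a singleton. *)
  have eN : kind e = Normal.
    have := leq_imset_card fV (ends e); rewrite -endE !ends_card dN.
    by case: (kind e).
  have := ends_card e; rewrite eN => /eqP /cards2P [a [b [ab eab]]].
  have := ends_card d; rewrite dN endE eab imsetU1 imset_set1 cards2.
  case: (altP (fV a =P fV b)) => // fab _.
  have : x \in [set fV a; fV b].
    by move: xd; rewrite endE eab imsetU1 imset_set1.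
  have inc u : incidence u e = (u == a) || (u == b).
    by rewrite /incidence eab !inE eN; case: ifP.
  have sum1 c c' : fV c = x -> fV c' != x ->
      (forall u, incidence u e = (u == c) || (u == c')) ->
      \sum_(u | fV u == x) incidence u e = 1.
    move=> cx c'x incc; rewrite (bigD1 c) ?cx //= incc eqxx big1 // => u.
    case/andP=> /eqP ux uc; rewrite incc (negPf uc) /=.
    by case: eqP => // uc'; rewrite -uc' ux eqxx in c'x.
  rewrite !inE => /orP[] /eqP xE.
    by apply: (sum1 a b) => //; rewrite xE // eq_sym.
  by apply: (sum1 b a) => [||u]; rewrite ?xE // inc orbC.
rewrite -!sum1_card.
transitivity (\sum_(u | fV u == x) \sum_(e | fE e == d) incidence u e).
  apply: eq_big => [u|u]; by rewrite inE // => /eqP/incE.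
rewrite exchange_big /=.
by apply: eq_big => [e|e /eqP /incV]; rewrite ?inE.
Qed.

(** Loops and semi-edges have a single end, so they force [x = y]; both fibers at a normal edge are
    as large as the fiber of that edge. *)
Lemma card_fiber_adjacent x y : adjacent x y ->
  #|[set u | fV u == x]| = #|[set u | fV u == y]|.
Proof.
case/existsP=> d /andP[xd yd].
case dN: (kind d); first by rewrite !(card_fiber_end dN).
all: have /eqP/cards1P[z dz] : #|ends d| = 1 by rewrite ends_card dN.
all: by move: xd yd; rewrite dz !inE => /eqP-> /eqP->.
Qed.

Lemma card_fiber_const x y : connected H ->
  #|[set u | fV u == x]| = #|[set u | fV u == y]|.
Proof.
move=> cH; have /connectP[p] := cH x y.
elim: p x => [|z p IHp] x /=; first by move=> _ ->.
by case/andP=> /card_fiber_adjacent-> pz yl; apply: IHp.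
Qed.

End ConstantFibers.

Lemma covers_dvdn_card (G H : graph) : connected H -> covers G H ->
  #|vertex H| %| #|vertex G|.
Proof.
move=> cH [fV [fE fP]].
have -> : #|vertex G| = \sum_(x : vertex H) #|[set u | fV u == x]|.
  rewrite -sum1_card (partition_big fV predT) //=.
  by apply: eq_bigr => x _; rewrite -sum1_card; apply: eq_bigl => u; rewrite inE.
(* Without vertices in [H] the sum is empty, and everything divides 0. *)
case: (pickP (vertex H)) => [x0 _|H0]; last by rewrite big_pred0 ?dvdn0.
under eq_bigr => x _ do rewrite (card_fiber_const fP x x0 cH).
by rewrite sum_nat_const dvdn_mulr.
Qed.

(** * Derived graphs of permutation voltages *)

Lemma ends_orientation (G : graph) :
  exists st : edge G -> vertex G * vertex G,
    forall e, ends e = [set (st e).1; (st e).2].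
Proof.
apply: (@fin_all_exists _ _ (fun e st => ends e = [set st.1; st.2])) => e.
have := ends_card e; case: (kind e) => /eqP.
- by case/cards2P=> a [b [_ ->]]; exists (a, b).
- by case/cards1P=> a ->; exists (a, a); rewrite setUid.
by case/cards1P=> a ->; exists (a, a); rewrite setUid.
Qed.

(* Ordinary voltage graphs, with permutations of the fiber as voltages.  An
   edge of the derived graph is an edge of A together with the pair of its
   ends: recording the unordered pair is what identifies the two lifts
   starting at the two ends of an edge above a semi-edge. *)
Section DerivedGraph.

Variables (A : graph) (st : edge A -> vertex A * vertex A).
Hypothesis stE : forall e, ends e = [set (st e).1; (st e).2].
Variables (F : finType) (p : edge A -> {perm F}).
(** [p_nofix] gives every lift two distinct ends, [p_sep] and [p_back] exclude parallel lifts, and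
    [p_semi] merges the lifts above a semi-edge in pairs. *)
Hypothesis p_nofix : forall e x, p e x <> x.
Hypothesis p_sep : forall e e' x, p e x = p e' x -> e = e'.
Hypothesis p_back : forall e e' x, p e' (p e x) = x -> e = e' /\ kind e = Semi.
Hypothesis p_semi : forall e x, kind e = Semi -> p e (p e x) = x.

Definition edge_lift (e : edge A) (x : F) : {set vertex A * F} :=
  [set ((st e).1, x); ((st e).2, p e x)].

Definition derived_edge : finType :=
  {d : edge A * {set vertex A * F} | [exists x, d.2 == edge_lift d.1 x]}.

Lemma derived_ends_card (d : derived_edge) : #|(val d).2| = 2.
Proof.
case: d => -[e S] /= /existsP[x /eqP->]; rewrite cards2 xpair_eqE.
by case: (altP (x =P p e x)) => [xp|]; rewrite ?andbF //; case: (@p_nofix e x).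
Qed.

Definition derived_graph : graph :=
  @Graph (vertex A * F)%type derived_edge (fun=> Normal)
    (fun d => (val d).2) derived_ends_card.

(** Lifts with the same ends run in the same direction, where [p_sep] applies, or in opposite
    directions, where [p_back] does. *)
Lemma derived_simple : simple derived_graph.
Proof.
split=> // d d' /= eqS; apply: val_inj.
move: d d' eqS => [[e S] /= dP] [[e' S'] /= d'P] eqS.
rewrite {}eqS in dP *; congr pair.
case/existsP: dP d'P => x /eqP-> /existsP[y /eqP eqS].
have: ((st e).1, x) \in edge_lift e x by rewrite !inE eqxx.
have: ((st e).2, p e x) \in edge_lift e x by rewrite !inE eqxx orbT.
rewrite eqS !inE !xpair_eqE.
case/orP=> /andP[_ /eqP px]; case/orP=> /andP[_ /eqP xy].
- by case: (@p_nofix e x); rewrite px.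
- by rewrite -px in xy; case: (@p_back e e' x).
- by rewrite -xy in px; apply: p_sep px.
by case: (@p_nofix e x); rewrite px.
Qed.

Definition derived_proj (d : edge derived_graph) : edge A := (val d).1.

Lemma lift_subproof e x :
  [exists y, (e, edge_lift e x).2 == edge_lift (e, edge_lift e x).1 y].
Proof. by apply/existsP; exists x. Qed.

Definition derived_lift e x : edge derived_graph :=
  Sub (e, edge_lift e x) (lift_subproof e x).

Lemma derived_liftP (d : edge derived_graph) :
  exists x, d = derived_lift (derived_proj d) x.
Proof.
case: d => -[e S] dP; have /existsP[x /= /eqP Sx] := dP.
by exists x; apply: val_inj; congr pair.
Qed.

Lemma derived_lift_inj e x y : derived_lift e x = derived_lift e y ->
  x = y \/ (x = p e y /\ kind e = Semi).
Proof.
move/(congr1 val) => /= -[eqS].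
have: ((st e).1, x) \in edge_lift e x by rewrite !inE eqxx.
have: ((st e).2, p e x) \in edge_lift e x by rewrite !inE eqxx orbT.
rewrite eqS !inE !xpair_eqE.
case/orP=> /andP[_ /eqP px]; case/orP=> /andP[_ /eqP xy]; try by left.
- by right; split=> //; rewrite xy in px; case: (p_back px).
- by left; apply: perm_inj px.
Qed.

(** The lifts of [d] at [(u, x)] are the one leaving it and the one entering it. Both occur when [d]
    is a loop or semi-edge at [u], and they coincide exactly for a semi-edge; at an end of a normal
    edge only one occurs. *)
Lemma sum_derived_incidence u x d :
  \sum_(e | derived_proj e == d) @incidence derived_graph (u, x) e =
  incidence u d.
Proof.
have incE e : @incidence derived_graph (u, x) e = ((u, x) \in (val e).2).
  by rewrite /incidence /=; case: ifP.
have -> : \sum_(e | derived_proj e == d) @incidence derived_graph (u, x) e =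
    #|[set e | (derived_proj e == d) && ((u, x) \in (val e).2)]|.
  rewrite -sum1_card big_mkcond [RHS]big_mkcond; apply: eq_bigr => e _.
  by rewrite incE inE; case: eqP => //= _; case: (_ \in _).
pose out := derived_lift d x; pose inn := derived_lift d ((p d)^-1%g x).
have -> : [set e | (derived_proj e == d) && ((u, x) \in (val e).2)] =
    [set e | (u == (st d).1) && (e == out) || (u == (st d).2) && (e == inn)].
  apply/setP=> e; rewrite !inE; apply/andP/orP.
    case=> /eqP ed; have [y ye] := derived_liftP e; rewrite ed in ye.
    rewrite ye /=.
    rewrite !inE !xpair_eqE => /orP[] /andP[-> /eqP xy].
      by left; rewrite /out xy /=.
    by right; rewrite /inn xy permK /=.
  case=> /andP[/eqP uE /eqP ->]; rewrite /= /edge_lift !inE uE ?permKV ?eqxx //.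
  by rewrite orbT.
rewrite /incidence stE !inE.
have inn_out : inn = out -> kind d = Semi.
  case/derived_lift_inj=> [xE|[]//].
  by case: (@p_nofix d x); rewrite -{1}xE permKV.
(* An involution is its own inverse, and a semi-edge starts and ends at the same vertex, so both
   lifts have the same pair of ends. *)
have out_inn : kind d = Semi -> inn = out.
  move=> dS; apply: val_inj; rewrite /= /edge_lift permKV.
  have -> : (p d)^-1%g x = p d x.
    by apply: (@perm_inj _ (p d)); rewrite permKV p_semi.
  have /eqP/cards1P[z dz] : #|ends d| = 1 by rewrite ends_card dS.
  have [-> ->] : (st d).1 = z /\ (st d).2 = z.
    move: (stE d); rewrite dz => /setP eqz.
    by split; apply/set1P; rewrite eqz !inE eqxx ?orbT.
  by rewrite setUC.
case u1: (u == _); case u2: (u == _); rewrite /=.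
- have st12 : (st d).1 = (st d).2 by rewrite -(eqP u1) -(eqP u2).
  have : #|ends d| = 1 by rewrite stE st12 setUid cards1.
  have -> : [set e | (e == out) || (e == inn)] = [set out; inn].
    by apply/setP => e; rewrite !inE.
  rewrite ends_card cards2; case dK: (kind d) => // _.
    by case: eqP => // oi; rewrite -oi in inn_out; rewrite inn_out in dK.
  by rewrite out_inn // eqxx.
- have -> : [set e | (e == out) || false] = [set out].
    by apply/setP => e; rewrite !inE orbF.
  rewrite cards1; case dK: (kind d) => //.
  have : #|ends d| = 1 by rewrite ends_card dK.
  by rewrite stE cards2 -(eqP u1) u2.
- have -> : [set e | e == inn] = [set inn] by apply/setP => e; rewrite !inE.
  rewrite cards1; case dK: (kind d) => //.
  have : #|ends d| = 1 by rewrite ends_card dK.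
  by rewrite stE cards2 -(eqP u2) eq_sym u1.
by apply/eqP; rewrite cards_eq0; apply/eqP/setP => e; rewrite !inE.
Qed.

(** The point of [F] gives surjectivity; the degree condition follows from the local bijection. *)
Lemma derived_covers : F -> covers derived_graph A.
Proof.
move=> x0; exists fst, derived_proj.
have bij (u : vertex derived_graph) :
    perm_eq (map derived_proj (edge_nbhd u)) (edge_nbhd u.1).
  rewrite /perm_eq; apply/allP => d _ /=; case: u => u x.
  by rewrite count_map_edge_nbhd count_edge_nbhd sum_derived_incidence.
split=> //.
- by move=> u; exists (u, x0).
- by move=> d; exists (derived_lift d x0).
- by move=> u; rewrite -!size_edge_nbhd -(perm_size (bij u)) size_map.
move=> e; have [x ->] := derived_liftP e.
by rewrite stE /= /edge_lift imsetU1 imset_set1.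
Qed.

End DerivedGraph.

(** The derived graph is a simple cover of [A], hence a cover of [B]. *)
Lemma stronger_voltage_dvdn (A B : graph) (F : finType) (p : edge A -> {perm F}) :
    connected B -> stronger A B ->
    (forall e x, p e x <> x) ->
    (forall e e' x, p e x = p e' x -> e = e') ->
    (forall e e' x, p e' (p e x) = x -> e = e' /\ kind e = Semi) ->
    (forall e x, kind e = Semi -> p e (p e x) = x) ->
    0 < #|F| ->
  #|vertex B| %| #|vertex A| * #|F|.
Proof.
move=> cB AB p_nofix p_sep p_back p_semi /card_gt0P[x0 _].
have [st stE] := ends_orientation A.
rewrite -card_prod; apply: (@covers_dvdn_card (derived_graph st p_nofix)) => //.
by apply: AB; [apply: derived_simple | apply: derived_covers].
Qed.

(** * Cyclic voltages and their doubling for semi-edges *)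

Section Voltages.

Variables (A : graph) (n : nat).
Hypothesis n_large : 2 * #|edge A| <= n.

Local Open Scope ring_scope.

(* The voltages 1, 2, ..., m together with their opposites are 2 m distinct
   nonzero residues modulo n + 1. *)
Definition cyclic_voltage (e : edge A) : 'I_n.+1 := inord (enum_rank e).+1.

Lemma enum_rank_lt_card (e : edge A) : (enum_rank e < #|edge A|)%N.
Proof. exact: ltn_ord. Qed.

Lemma cyclic_voltageE e : cyclic_voltage e = (enum_rank e).+1 :> nat.
Proof. by rewrite inordK //; have := enum_rank_lt_card e; lia. Qed.

Lemma cyclic_voltage_neq0 e : cyclic_voltage e <> 0.
Proof. by move/(congr1 val); rewrite /= cyclic_voltageE. Qed.

Lemma cyclic_voltage_inj : injective cyclic_voltage.
Proof.
move=> e e' /(congr1 val) /=; rewrite !cyclic_voltageE => -[].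
by move/ord_inj/enum_rank_inj.
Qed.

(** The sum lies between 2 and [2 * #|edge A|], so it does not wrap around modulo [n.+1]. *)
Lemma cyclic_voltage_add_neq0 e e' :
  cyclic_voltage e + cyclic_voltage e' <> 0.
Proof.
move/(congr1 val); rewrite /= !cyclic_voltageE.
have := enum_rank_lt_card e; have := enum_rank_lt_card e'.
by move=> ? ?; rewrite modn_small; lia.
Qed.

Definition shift_perm e : {perm 'I_n.+1} := perm (addIr (cyclic_voltage e)).

Lemma stronger_cyclic_dvdn (B : graph) : connected B -> stronger A B ->
  has_no_semi_edges A -> (#|vertex B| %| #|vertex A| * n.+1)%N.
Proof.
move=> cB AB noS; rewrite -[n.+1]card_ord.
apply: (@stronger_voltage_dvdn _ _ _ shift_perm) => //.
- by move=> e x; rewrite permE -[RHS]addr0 => /addrI/cyclic_voltage_neq0.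
- by move=> e e' x; rewrite !permE => /addrI/cyclic_voltage_inj.
- move=> e e' x; rewrite !permE -addrA -[RHS]addr0.
  by move/addrI/cyclic_voltage_add_neq0.
- by move=> e x /noS.
by rewrite card_ord.
Qed.

(* A semi-edge needs a fixed-point-free involution, so it exchanges two copies
   of the cyclic fiber. *)
Definition flip_fun e (z : 'I_n.+1 * bool) : 'I_n.+1 * bool :=
  if kind e is Semi then
    (if z.2 then z.1 - cyclic_voltage e else z.1 + cyclic_voltage e, ~~ z.2)
  else (z.1 + cyclic_voltage e, z.2).

Lemma flip_fun_inj e : injective (flip_fun e).
Proof.
move=> [x b] [y c]; rewrite /flip_fun; case: (kind e) => /=.
- by case/pair_equal_spec=> /addIr-> ->.
- by case/pair_equal_spec=> /addIr-> ->.
by case: b c => -[] /= /pair_equal_spec[] // /addIr->.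
Qed.

Definition flip_perm e := perm (@flip_fun_inj e).

Lemma stronger_dihedral_dvdn (B : graph) : connected B -> stronger A B ->
  (#|vertex B| %| #|vertex A| * (n.+1 * 2))%N.
Proof.
move=> cB AB; rewrite -[n.+1]card_ord -card_bool -card_prod.
apply: (@stronger_voltage_dvdn _ _ _ flip_perm) => //.
- move=> e [x b]; rewrite permE /flip_fun.
  case: (kind e) => //= /pair_equal_spec[]; last by case: b.
  + by rewrite -[RHS]addr0 => /addrI/cyclic_voltage_neq0.
  + by rewrite -[RHS]addr0 => /addrI/cyclic_voltage_neq0.
- move=> e e' [x b]; rewrite !permE /flip_fun.
  case: (kind e) (kind e') => -[] //=; case: b => //= /pair_equal_spec[];
    by [move/addrI/cyclic_voltage_inj | move/addrI/oppr_inj/cyclic_voltage_inj].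
- move=> e e' [x b]; rewrite !permE /flip_fun.
  (* Exactly one semi-edge among [e] and [e'] changes the copy; two other edges shift by a nonzero
     sum; two semi-edges shift by a difference of voltages, zero only if [e = e']. *)
  have rot y : y + cyclic_voltage e + cyclic_voltage e' <> y.
    by rewrite -addrA -[RHS]addr0 => /addrI/cyclic_voltage_add_neq0.
  case eK: (kind e); case: (kind e') => //=; case: b => //= /pair_equal_spec[] //;
    try by move/rot.
  + rewrite -addrA -[RHS]addr0 => /addrI; rewrite addrC => /subr0_eq.
    by move/cyclic_voltage_inj.
  + rewrite -addrA -[RHS]addr0 => /addrI/subr0_eq.
    by move/cyclic_voltage_inj.
- move=> e [x b] eS; rewrite !permE /flip_fun eS.
  (* The opposite signs on the two copies cancel. *)
  by case: b; rewrite /= ?addrK ?subrK.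
by rewrite card_prod card_ord card_bool.
Qed.

End Voltages.

Lemma dvdn_mul_consecutive d a n :
  d %| a * n -> d %| a * n.+1 -> d %| a.
Proof. by move=> dn; rewrite mulnS dvdn_addl. Qed.

Theorem theorem2 (A B : graph) (cA : connected A) (cB : connected B)
    (AB : stronger A B) :
  #|vertex B| %| 2 * #|vertex A| /\
  (has_no_semi_edges A -> #|vertex B| %| #|vertex A|).
Proof.
(* The bound [n_large] holds for [n] and for [n.+1], giving cyclic groups of consecutive orders
   [n.+1] and [n.+2]. *)
pose n := 2 * #|edge A|; split=> [|noS].
  rewrite mulnC; apply: (@dvdn_mul_consecutive _ _ n.+1);
    rewrite -mulnA [2 * _]mulnC; exact: stronger_dihedral_dvdn.
by apply: (@dvdn_mul_consecutive _ _ n.+1); apply: stronger_cyclic_dvdn.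
Qed.
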